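(* For every $r\in(0,1)$ and every $\xi\in\mathbb{C}$ with $|\xi|=1$, one has $\Phi(-r\xi,\xi)<0$.
   Context: $D=\{z\in\mathbb{C}:|z|<1\}$. For a holomorphic $p:D\to\mathbb{C}$ put $$\Lambda[p](z)=2\,\mathrm{Re}(p(z))\,\frac{1+|z|^2}{1-|z|^2}+2\,\mathrm{Re}(z\,p'(z)),\qquad z\in D.$$ For $|\xi|=1$ let $p_\xi(z)=\dfrac{\xi+z}{\xi-z}$ (the function with Herglotz measure $\delta_\xi$), and define $\Phi(z,\xi)=\Lambda[p_\xi](z)-2$ for $z\in D$. *)

(* Defs.v *)
From Stdlib Require Import Reals Lra Psatz.
From Coquelicot Require Import Coquelicot.
Open Scope R_scope.

Definition holomorphic_on_disc (p : C -> C) : Prop :=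
  forall z : C, Cmod z < 1 ->
    @ex_derive C_AbsRing C_NormedModule p z.

(** Functions on the unit disc are represented by total functions [C -> C], and
    [C_derive p z] is the complex derivative p'(z) wherever [p] is complex
    differentiable. Hence [Lambda p z] is meaningful when [p] is holomorphic on
    the disc and [Cmod z < 1]: it then depends only on [p] inside the disc. *)
Definition Lambda (p : C -> C) (z : C) : R :=
  2 * Re (p z) * ((1 + Cmod z ^ 2) / (1 - Cmod z ^ 2))
  + 2 * Re (z * C_derive p z)%C.

(** The integral of (eta + z) / (eta - z) against the Dirac mass at [xi]. *)
Definition herglotz_kernel (xi z : C) : C := ((xi + z) / (xi - z))%C.

Definition Phi (z xi : C) : R := Lambda (herglotz_kernel xi) z - 2.

(** [Phi z xi] is a legitimate instance of [Lambda]: the kernel is holomorphic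
    on the disc when |xi| = 1. *)
Lemma herglotz_kernel_holomorphic (xi : C) :
  Cmod xi = 1 -> holomorphic_on_disc (herglotz_kernel xi).
Proof.
intros Hxi z Hz.
assert (Hd : 0 < Cmod (xi - z)%C).
{ pose proof (Cmod_triangle (xi - z)%C z) as T.
  replace (xi - z + z)%C with xi in T by ring. lra. }
set (d := Cmod (xi - z)%C) in *.
exists (2 * xi / ((xi - z) * (xi - z)))%C.
split; [apply is_linear_scal_l|].
intros x Hx.
apply (@is_filter_lim_locally_unique C_AbsRing (AbsRing_NormedModule C_AbsRing))
  in Hx; subst x.
intros [eps Heps]; simpl.
assert (Hd3 : 0 < eps * (d * d * d) / 4).
{ assert (0 < d * d * d) by (repeat apply Rmult_lt_0_compat; lra). nra. }
assert (Hdel : 0 < Rmin (d / 2) (eps * (d * d * d) / 4))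
  by (apply Rmin_glb_lt; lra).
exists (mkposreal _ Hdel); intros y Hy.
change (Cmod (y - z)%C < Rmin (d / 2) (eps * (d * d * d) / 4)) in Hy.
assert (Hy1 := Rlt_le_trans _ _ _ Hy (Rmin_l _ _)).
assert (Hy2 := Rlt_le_trans _ _ _ Hy (Rmin_r _ _)).
change (Cmod (herglotz_kernel xi y - herglotz_kernel xi z
  - (y - z) * (2 * xi / ((xi - z) * (xi - z))))%C <= eps * Cmod (y - z)%C).
assert (He : d / 2 < Cmod (xi - y)%C).
{ pose proof (Cmod_triangle (xi - y)%C (y - z)%C) as T.
  replace (xi - y + (y - z))%C with (xi - z)%C in T by ring.
  fold d in T. lra. }
assert (Nz : (xi - z)%C <> 0) by (apply Cmod_gt_0; exact Hd).
assert (Ny : (xi - y)%C <> 0) by (apply Cmod_gt_0; lra).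
replace (herglotz_kernel xi y - herglotz_kernel xi z
  - (y - z) * (2 * xi / ((xi - z) * (xi - z))))%C
  with (2 * xi * (y - z) * (y - z) / ((xi - y) * (xi - z) * (xi - z)))%C
  by (unfold herglotz_kernel; field; split; assumption).
rewrite Cmod_div by (repeat apply Cmult_neq_0; assumption).
rewrite !Cmod_mult, Hxi, Cmod_R, (Rabs_pos_eq 2) by lra.
fold d.
set (e := Cmod (xi - y)%C) in *; set (t := Cmod (y - z)%C) in *.
assert (Ht : 0 <= t) by apply Cmod_ge_0.
apply Rle_div_l; [repeat apply Rmult_lt_0_compat; lra|].
assert (E : 2 * t <= eps * (e * d * d)).
{ assert (0 < eps * (d * d)) by (repeat apply Rmult_lt_0_compat; lra). nra. }
nra.
Qed.

(* Main.v *)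
Require Import Defs.
From Stdlib Require Import Reals Lra.
From Coquelicot Require Import Coquelicot.
Open Scope R_scope.

(** Everything is explicit on the ray opposite to [xi].  At [z = - r xi] one has
    [xi - z = (1 + r) xi] and [xi + z = (1 - r) xi], so the unimodular factor
    cancels: the kernel [p] takes the real value [(1 - r) / (1 + r)], and
    [p'(z) = 2 xi / (xi - z)^2] gives [z p'(z) = - 2 r / (1 + r)^2].  Since
    [1 - |z|^2 = (1 - r) (1 + r)], both terms of [Lambda] have denominator
    [(1 + r)^2] and [Lambda = 2 ((1 - r) / (1 + r))^2], which is below [2].

    The derivative of [p] is obtained without differentiating a quotient: [p] is
    known to be holomorphic, so the product rule applied to
    [p(w) (xi - w) = xi + w] leaves a linear equation for [p'(z)]. *)

(** [C] carries two normed module structures over itself, with different balls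
    but the same norm [Cmod].  The notion of derivative only uses the norm of
    the target, so it does not distinguish them.  Rules for products need the
    ring structure, while [C_derive] is specified with the other one. *)
Lemma is_derive_C_AbsRing (f : C -> C) (z l : C) :
  @is_derive C_AbsRing C_NormedModule f z l <->
  @is_derive C_AbsRing (AbsRing_NormedModule C_AbsRing) f z l.
Proof.
split; intros [_ Hdom]; (split; [apply is_linear_scal_l | exact Hdom]).
Qed.

Lemma C_derive_herglotz_kernel (xi z : C) :
  Cmod xi = 1 -> Cmod z < 1 ->
  C_derive (herglotz_kernel xi) z = (2 * xi / ((xi - z) * (xi - z)))%C.
Proof.
intros Hxi Hz.
assert (Hd : 0 < Cmod (xi - z)%C).
{ pose proof (Cmod_triangle (xi - z)%C z) as T.
  replace (xi - z + z)%C with xi in T by ring. lra. }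
assert (Nz : (xi - z)%C <> 0) by (apply Cmod_gt_0; exact Hd).
pose proof (C_derive_correct _ z z (herglotz_kernel_holomorphic xi Hxi z Hz)) as Hp.
set (l := C_derive (herglotz_kernel xi) z) in *.
apply is_derive_C_AbsRing in Hp.
assert (Hminus : @is_derive C_AbsRing (AbsRing_NormedModule C_AbsRing)
    (fun w : C => (xi - w)%C) z (0 - 1)%C).
{ apply (@is_derive_minus C_AbsRing (AbsRing_NormedModule C_AbsRing)
    (fun _ => xi) (fun w => w)).
  - apply (@is_derive_const C_AbsRing (AbsRing_NormedModule C_AbsRing)).
  - apply (@is_derive_id C_AbsRing). }
assert (Hplus : @is_derive C_AbsRing (AbsRing_NormedModule C_AbsRing)
    (fun w : C => (xi + w)%C) z (0 + 1)%C).
{ apply (@is_derive_plus C_AbsRing (AbsRing_NormedModule C_AbsRing)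
    (fun _ => xi) (fun w => w)).
  - apply (@is_derive_const C_AbsRing (AbsRing_NormedModule C_AbsRing)).
  - apply (@is_derive_id C_AbsRing). }
pose proof (@is_derive_mult C_AbsRing _ _ z _ _ Hp Hminus Cmult_comm) as Hprod.
(* [p(w) (xi - w) = xi + w] fails at the pole [w = xi], hence only near [z]. *)
apply (@is_derive_ext_loc C_AbsRing (AbsRing_NormedModule C_AbsRing) _
  (fun w : C => (xi + w)%C)) in Hprod.
2:{ exists (mkposreal _ Hd); intros w Hw.
  change (Cmod (w - z)%C < Cmod (xi - z)%C) in Hw.
  change ((xi + w) / (xi - w) * (xi - w) = xi + w)%C.
  field. intros E.
  replace w with xi in Hw; [lra|].
  replace xi with ((xi - w) + w)%C by ring. rewrite E. ring. }
apply is_derive_C_AbsRing, is_C_derive_unique in Hprod.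
apply is_derive_C_AbsRing, is_C_derive_unique in Hplus.
rewrite Hplus in Hprod.
change ((0 + 1 = l * (xi - z) + herglotz_kernel xi z * (0 - 1))%C) in Hprod.
replace l with ((l * (xi - z) + herglotz_kernel xi z * (0 - 1)
                 + herglotz_kernel xi z) / (xi - z))%C by (field; exact Nz).
rewrite <- Hprod. unfold herglotz_kernel. field. exact Nz.
Qed.

Lemma Phi_antipodal (r : R) (xi : C) :
  0 <= r < 1 -> Cmod xi = 1 ->
  Phi (- (RtoC r * xi))%C xi = - (8 * r / (1 + r) ^ 2).
Proof.
intros Hr Hxi.
assert (Hmod : Cmod (- (RtoC r * xi))%C = r).
{ rewrite Cmod_opp, Cmod_mult, Hxi, Cmod_R, Rabs_pos_eq; lra. }
assert (Nxi : xi <> 0) by (apply Cmod_gt_0; lra).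
assert (Nr : (1 + r)%C <> 0).
{ rewrite <- RtoC_plus. intros E. apply RtoC_inj in E. lra. }
assert (Nd : (xi - - (r * xi))%C <> 0).
{ replace (xi - - (r * xi))%C with ((1 + r) * xi)%C by ring.
  apply Cmult_neq_0; assumption. }
assert (Hval : herglotz_kernel xi (- (r * xi))%C = RtoC ((1 - r) / (1 + r))).
{ unfold herglotz_kernel.
  rewrite RtoC_div, RtoC_minus, RtoC_plus by lra.
  field. split; assumption. }
assert (Hder : (- (r * xi) * C_derive (herglotz_kernel xi) (- (r * xi)))%C
               = RtoC (- (2 * r) / ((1 + r) * (1 + r)))).
{ rewrite C_derive_herglotz_kernel by lra.
  rewrite RtoC_div, RtoC_opp, !RtoC_mult, RtoC_plus by nra.
  field. split; assumption. }
unfold Phi, Lambda.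
rewrite Hmod, Hval, Hder, !re_RtoC.
field. split; nra.
Qed.

Theorem corollary2 :
  forall (r : R) (xi : C),
    0 < r < 1 -> Cmod xi = 1 ->
    Phi (- (RtoC r * xi))%C xi < 0.
Proof.
intros r xi Hr Hxi.
rewrite Phi_antipodal by lra.
assert (0 < 8 * r / (1 + r) ^ 2).
{ apply Rdiv_lt_0_compat; [lra | apply pow_lt; lra]. }
lra.
Qed.
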